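(* Let $n\ge 5$ and let $v:\mathbb{C}[\mathscr{G}(3,n)]\to\mathbb{C}$ be an algebra homomorphism. Assume that $v(\{i,i+1,i+2\})=1$ for all $i\in[n]$, i.e. $v$ takes the value $1$ on all continuous Plücker variables. For $i\in[n]$ and $3\le k<n-3$ we have the recursive formulas $$\Delta_k(i)=\Delta_1(i)\,\Delta_{k-1}(i+1)-\Delta^1(i+1)\,\Delta_{k-2}(i+2)+\Delta_{k-3}(i+3)$$ and $$\Delta^k(i)=\Delta^1(i+k-1)\,\Delta^{k-1}(i)-\Delta_1(i+k-2)\,\Delta^{k-2}(i)+\Delta^{k-3}(i).$$ For $k=2$ we have $$\Delta_2(i)=\Delta_1(i)\,\Delta_1(i+1)-\Delta^1(i+1)$$ and $$\Delta^2(i)=\Delta^1(i+1)\,\Delta^1(i)-\Delta_1(i).$$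
   Context: Let $[n]=\{1,\dots,n\}$, with indices taken modulo $n$. $\mathscr{G}(3,n)$ is the Grassmannian of $3$-dimensional subspaces of $\mathbb{C}^n$ and $\mathbb{C}[\mathscr{G}(3,n)]$ is its homogeneous coordinate ring with respect to the Plücker embedding. It is generated by the Plücker coordinates (Plücker variables) $\Delta^{a,b,c}$, antisymmetric in their indices, modulo the Plücker relations. For a $3$-element subset $\{a,b,c\}\subset[n]$, write $v(\{a,b,c\}):=v(\Delta^{a',b',c'})$ where $a'<b'<c'$ are the elements $a,b,c$ in increasing order. Continuous Plücker variables are those with index set $\{i,i+1,i+2\}$ (indices modulo $n$). For $k\geq 0$ and $i\in[n]$ one writes $$\Delta_k(i):=v(\{i,i+1,i+k+2\}),\qquad \Delta^k(i):=v(\{i,i+k+1,i+k+2\}),$$ with indices modulo $n$ (defined whenever the three indices are distinct). *)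

(* Defs.v *)
From HB Require Import structures.
From mathcomp Require Import all_boot all_order all_algebra.
From mathcomp Require Import ring_quotient boolp reals.
From mathcomp Require Import complex mpoly ring.

Set Implicit Arguments.
Unset Strict Implicit.
Unset Printing Implicit Defensive.

Import GRing.Theory.
Local Open Scope ring_scope.

(* One variable for every ordered triple of indices: antisymmetry is imposed
   by the relations below. *)
Notation pluckerPoly R n :=
  {mpoly (complex R)[#|{: 'I_n * 'I_n * 'I_n}|]}.

Section CoordinateRing.
Variables (R : realType) (n : nat).

Local Notation plucker_poly := (pluckerPoly R n).

Definition plucker_var (a b c : 'I_n) : plucker_poly := 'X_(enum_rank (a, b, c)).

Local Notation X := plucker_var.

(* The two transpositions generate the antisymmetry under all of S_3 (and
   X a a c = 0, as 2 is invertible). The last constructor is the relation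
   sum_l (-1)^l X a b j_l * X (j_0 .. omit j_l .. j_3) = 0. *)
Inductive plucker_relation : plucker_poly -> Prop :=
| PluckerAntisymL a b c : plucker_relation (X a b c + X b a c)
| PluckerAntisymR a b c : plucker_relation (X a b c + X a c b)
| PluckerQuadratic a b j0 j1 j2 j3 :
    plucker_relation (X a b j0 * X j1 j2 j3 - X a b j1 * X j0 j2 j3
                      + X a b j2 * X j0 j1 j3 - X a b j3 * X j0 j1 j2).

Definition in_plucker_ideal (p : plucker_poly) : Prop :=
  exists s : seq (plucker_poly * plucker_poly),
    (forall x, x \in s -> plucker_relation x.2) /\
    p = \sum_(x <- s) x.1 * x.2.

Definition plucker_ideal : plucker_poly -> bool :=
  fun p => `[< in_plucker_ideal p >].

Definition minor (M : 'M[R[i]]_(3, n)) (a b c : 'I_n) : R[i] :=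
  \det (colsub (tnth [tuple a; b; c]) M).

Lemma minorE M a b c : minor M a b c =
  M 0 a * (M 1 b * M 2 c - M 1 c * M 2 b)
  - M 0 b * (M 1 a * M 2 c - M 1 c * M 2 a)
  + M 0 c * (M 1 a * M 2 b - M 1 b * M 2 a).
Proof.
rewrite /minor (expand_det_row _ ord0) !big_ord_recl big_ord0 /cofactor.
rewrite !(expand_det_row _ ord0) !big_ord_recl !big_ord0 /cofactor.
rewrite !det_mx11 !mxE !(tnth_nth a) /=.
have e1 : lift ord0 (0 : 'I_2) = 1 :> 'I_3 by apply: val_inj.
have e2 : lift ord0 (lift ord0 (0 : 'I_1)) = 2 :> 'I_3 by apply: val_inj.
rewrite ?e1 ?e2 /bump /=; ring.
Qed.

(* The relations do hold on the Pluecker coordinates of 3 x n matrices. *)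
Lemma plucker_ideal_minor (M : 'M[R[i]]_(3, n)) (p : plucker_poly) :
  in_plucker_ideal p ->
  p.@[fun t => let: (a, b, c) := enum_val t in minor M a b c] = 0.
Proof.
have vX a b c : (X a b c).@[fun t => let: (a, b, c) := enum_val t in
    minor M a b c] = minor M a b c by rewrite mevalXU enum_rankK.
case=> s [rel_s ->]; rewrite raddf_sum big_seq big1 // => x /rel_s /=.
rewrite mevalM; case=> *; rewrite !(mevalD, mevalN, mevalM, vX) !minorE; ring.
Qed.

Lemma plucker_ideal_closed : idealr_closed plucker_ideal.
Proof.
split.
- by apply/asboolP; exists [::]; rewrite big_nil.
- apply/asboolP => /(plucker_ideal_minor 0).
  by rewrite meval1 => /eqP; rewrite oner_eq0.
- move=> a p q /asboolP[s [rel_s ->]] /asboolP[t [rel_t ->]]; apply/asboolP.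
  exists ([seq (a * x.1, x.2) | x <- s] ++ t); split.
    by move=> x; rewrite mem_cat => /orP[/mapP[y /rel_s ? ->]|/rel_t].
  rewrite big_cat big_map mulr_sumr; congr (_ + _).
  by apply: eq_bigr => x _; rewrite mulrA.
Qed.

HB.instance Definition _ :=
  isIdealr.Build plucker_poly plucker_ideal plucker_ideal_closed.

Definition grass_ring : Type :=
  {ideal_quot (plucker_ideal : idealr plucker_poly)}.

HB.instance Definition _ := GRing.ComNzRing.on grass_ring.

Definition grass_class (p : plucker_poly) : grass_ring :=
  \pi_({ideal_quot (plucker_ideal : idealr plucker_poly)})%qT p.

Lemma grass_class_is_zmod_morphism : zmod_morphism grass_class.
Proof. exact: pi_is_zmod_morphism. Qed.

Lemma grass_class_is_monoid_morphism : monoid_morphism grass_class.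
Proof. exact: pi_is_monoid_morphism. Qed.

HB.instance Definition _ := GRing.isZmodMorphism.Build plucker_poly grass_ring
  grass_class grass_class_is_zmod_morphism.
HB.instance Definition _ := GRing.isMonoidMorphism.Build plucker_poly grass_ring
  grass_class grass_class_is_monoid_morphism.

Definition grass_const (c : R[i]) : grass_ring := grass_class (c%:MP : plucker_poly).

Definition grass_scale (c : R[i]) (x : grass_ring) : grass_ring :=
  grass_const c * x.

Lemma grass_scaleA a b x :
  grass_scale a (grass_scale b x) = grass_scale (a * b) x.
Proof.
by rewrite /grass_scale mulrA /grass_const -(rmorphM grass_class) mpolyCM.
Qed.

Lemma grass_scale1 : left_id 1 grass_scale.
Proof. by move=> x; rewrite /grass_scale /grass_const mpolyC1 rmorph1 mul1r. Qed.

Lemma grass_scaleDr : right_distributive grass_scale +%R.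
Proof. by move=> a x y; rewrite /grass_scale mulrDr. Qed.

Lemma grass_scaleDl x :
  {morph grass_scale^~ x : a b / a + b >-> a + b}.
Proof.
move=> a b; rewrite /grass_scale -mulrDl; congr (_ * _).
by rewrite /grass_const mpolyCD (rmorphD grass_class).
Qed.

HB.instance Definition _ := GRing.Zmodule_isLmodule.Build R[i] grass_ring
  grass_scaleA grass_scale1 grass_scaleDr grass_scaleDl.

Lemma grass_scaleAl (a : R[i]) (x y : grass_ring) : a *: (x * y) = a *: x * y.
Proof. exact: mulrA. Qed.

HB.instance Definition _ :=
  GRing.Lmodule_isLalgebra.Build R[i] grass_ring grass_scaleAl.

Definition Plucker (a b c : 'I_n) : grass_ring :=
  grass_class (plucker_var a b c).

End CoordinateRing.

Section Values.
Variables (R : realType) (n : nat).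

(* Indices are 0-based: the ordinal i stands for the element i + 1 of [n], so
   the order on 'I_n is that of [n], and addition modulo n is cyclic shift. *)
Definition shift (i : 'I_n) (k : nat) : 'I_n := iter k (@ordS n) i.

Variable v : grass_ring R n -> R[i].

(* [enum A] lists the elements of A in increasing order; the value on sets
   that do not have exactly three elements is irrelevant. *)
Definition set_value (A : {set 'I_n}) : R[i] :=
  if enum A is [:: a; b; c] then v (Plucker R a b c) else 0.

Definition Delta_lower (k : nat) (i : 'I_n) : R[i] :=
  set_value [set i; shift i 1; shift i (k + 2)].

Definition Delta_upper (k : nat) (i : 'I_n) : R[i] :=
  set_value [set i; shift i (k + 1); shift i (k + 2)].

End Values.

(* Main.v *)
Require Import Defs.
From mathcomp Require Import all_boot all_order all_algebra.
From mathcomp Require Import ring_quotient boolp reals complex mpoly zify ring.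

(** Write [[a b c]] for v(Delta^{a,b,c}), the determinant of three vectors
    w_a, w_b, w_c of C^3. Four vectors of C^3 satisfy Cramer's relation
      [[b c d]] w_a - [[a c d]] w_b + [[a b d]] w_c - [[a b c]] w_d = 0,
    so when all determinants of consecutive vectors are 1 it reads
      w_i = [[i i+2 i+3]] w_{i+1} - [[i i+1 i+3]] w_{i+2} + w_{i+3}.
    Pairing it with w_{i+1} and an arbitrary w_x leaves
      [[i i+1 x]] = [[i i+1 i+3]] [[i+1 i+2 x]] - [[i+1 i+3 x]],
    and the same relation started at i+1, paired with w_{i+3} and w_x, gives
      [[i+1 i+3 x]] = [[i+1 i+3 i+4]] [[i+2 i+3 x]] - [[i+3 i+4 x]].
    Together they form the lower recursion ([plucker_recursion]), in which x is
    arbitrary: for x = i+k+2 it is the recursion for Delta_k(i), and for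
    k = 2, where x = i+4, the factor [[i+2 i+3 x]] is 1 and the last term
    vanishes. Reading the sequence of vectors backwards changes the sign of
    every determinant, hence the upper recursion is the lower one for the
    function -[[.]] on the reversed sequence ([plucker_recursion_rev]).

    The paired Cramer relations are instances of the quadratic Pluecker
    relations, so no vectors have to be constructed. The values in the
    theorem are attached to unordered sets, listed increasingly in [n];
    a triple in cyclic order becomes increasing after a cyclic rotation, which
    is even, so that the value of the set is [[i i+d i+e]] in all cases
    ([set_value_shift]). *)

Set Implicit Arguments.
Unset Strict Implicit.
Unset Printing Implicit Defensive.

Import GRing.Theory Num.Theory.
Local Open Scope ring_scope.

(** * Functions satisfying the Pluecker relations *)

(** The properties of the determinant of three vectors of K^3 among those
    indexed by T that the recursions need. *)
Record plucker_function (K : nzRingType) (T : Type) (p : T -> T -> T -> K) :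
    Prop := PluckerFunction {
  plucker_antisymL : forall a b c, p a b c = - p b a c;
  plucker_antisymR : forall a b c, p a b c = - p a c b;
  plucker_quadratic : forall a b j0 j1 j2 j3,
    p a b j0 * p j1 j2 j3 - p a b j1 * p j0 j2 j3
    + p a b j2 * p j0 j1 j3 - p a b j3 * p j0 j1 j2 = 0 }.

Section PluckerFunction.
Variables (K : numFieldType) (T : Type).
Implicit Types (p : T -> T -> T -> K) (a b c x y : T).

Lemma plucker_rot p a b c : plucker_function p -> p b c a = p a b c.
Proof.
by move=> P; rewrite (plucker_antisymR P) (plucker_antisymL P) opprK.
Qed.

Lemma plucker_rev p a b c : plucker_function p -> - p c b a = p a b c.
Proof.
by move=> P; rewrite (plucker_antisymL P) opprK -(plucker_rot a b c P).
Qed.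

Lemma plucker_aab p a b : plucker_function p -> p a a b = 0.
Proof.
move=> P; have /eqP := plucker_antisymL P a a b.
by rewrite -addr_eq0 -mulr2n mulrn_eq0 => /eqP.
Qed.

Lemma plucker_abb p a b : plucker_function p -> p a b b = 0.
Proof. by move=> P; rewrite -(plucker_rot a b b P) plucker_aab. Qed.

Lemma plucker_opp p :
  plucker_function p -> plucker_function (fun a b c => - p a b c).
Proof.
move=> P; split=> *; last by rewrite !mulrNN (plucker_quadratic P).
  by rewrite (plucker_antisymL P).
by rewrite (plucker_antisymR P).
Qed.

(** Cramer's relation between the vectors a, b, c, d, paired with b and x; the
    coefficient of w_b vanishes. *)
Lemma plucker_cramer2 p a b c d x : plucker_function p ->
  p a b x * p b c d = p a b d * p b c x - p a b c * p b d x.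
Proof.
move=> P; have := plucker_quadratic P b x a b c d.
rewrite (plucker_rot a b x P) (plucker_rot b b x P) plucker_aab //.
rewrite (plucker_antisymR P b x c) (plucker_antisymR P b x d) => E.
by apply/eqP; rewrite -subr_eq0 -E; apply/eqP; ring.
Qed.

(** Cramer's relation between the vectors a, b, c, d, paired with c and x; the
    coefficient of w_c vanishes. *)
Lemma plucker_cramer3 p a b c d x : plucker_function p ->
  p a c x * p b c d = p a c d * p b c x - p a b c * p c d x.
Proof.
move=> P; have := plucker_quadratic P c x a b c d.
rewrite (plucker_rot a c x P) (plucker_rot b c x P).
rewrite (plucker_rot c c x P) plucker_aab // (plucker_antisymR P c x d) => E.
by apply/eqP; rewrite -subr_eq0 -E; apply/eqP; ring.
Qed.

Lemma plucker_recursion p (a0 a1 a2 a3 a4 x : T) : plucker_function p ->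
  p a0 a1 a2 = 1 -> p a1 a2 a3 = 1 -> p a2 a3 a4 = 1 ->
  p a0 a1 x = p a0 a1 a3 * p a1 a2 x - p a1 a3 a4 * p a2 a3 x + p a3 a4 x.
Proof.
move=> P e0 e1 e2.
have := plucker_cramer2 a0 a1 a2 a3 x P; rewrite e0 e1 mulr1 mul1r => ->.
have := plucker_cramer3 a1 a2 a3 a4 x P; rewrite e1 e2 mulr1 mul1r => ->.
by ring.
Qed.

(** The forward recursion for -p along a4, a3, a2, a1, a0. *)
Lemma plucker_recursion_rev p (a0 a1 a2 a3 a4 x : T) : plucker_function p ->
  p a0 a1 a2 = 1 -> p a1 a2 a3 = 1 -> p a2 a3 a4 = 1 ->
  p x a3 a4 = p a1 a3 a4 * p x a2 a3 - p a0 a1 a3 * p x a1 a2 + p x a0 a1.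
Proof.
move=> P e0 e1 e2; have := plucker_recursion (a0 := a4) (a1 := a3) (a2 := a2)
  (a3 := a1) (a4 := a0) x (plucker_opp P).
by rewrite !(plucker_rev _ _ _ P); apply.
Qed.

End PluckerFunction.

(** * The coordinate ring *)

Lemma grass_class_relation (R : realType) (n : nat) (q : pluckerPoly R n) :
  plucker_relation q -> grass_class q = 0.
Proof.
move=> rel_q; rewrite -(rmorph0 (@grass_class R n)); apply/eqP.
rewrite /grass_class -Quotient.idealrBE subr0.
apply/asboolP; exists [:: (1, q)]; split; last by rewrite big_seq1 mul1r.
by move=> x; rewrite inE => /eqP->.
Qed.

Lemma plucker_function_morph (R : realType) (n : nat)
    (v : {rmorphism grass_ring R n -> R[i]}) :
  plucker_function (fun a b c => v (Plucker R a b c)).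
Proof.
split=> [a b c|a b c|a b j0 j1 j2 j3].
- have /(congr1 v) := grass_class_relation (PluckerAntisymL R a b c).
  rewrite (rmorphD (@grass_class R n)) rmorphD rmorph0 => /eqP.
  by rewrite addr_eq0 => /eqP.
- have /(congr1 v) := grass_class_relation (PluckerAntisymR R a b c).
  rewrite (rmorphD (@grass_class R n)) rmorphD rmorph0 => /eqP.
  by rewrite addr_eq0 => /eqP.
have /(congr1 v) := grass_class_relation (PluckerQuadratic R a b j0 j1 j2 j3).
rewrite (rmorphB (@grass_class R n)) (rmorphD (@grass_class R n)).
rewrite (rmorphB (@grass_class R n)) !(rmorphM (@grass_class R n)).
by rewrite rmorphB rmorphD rmorphB !rmorphM rmorph0.
Qed.

(** * Values on cyclically ordered triples *)

Lemma val_shift n (i : 'I_n) k : shift i k = ((i + k) %% n)%N :> nat.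
Proof.
elim: k => [|k IH]; first by rewrite addn0 modn_small.
by rewrite /shift iterS /= -/(shift i k) IH -addn1 modnDml addn1 addnS.
Qed.

Lemma shift_shift n (i : 'I_n) j k : shift (shift i j) k = shift i (k + j).
Proof. by rewrite /shift iterD. Qed.

Lemma enum_set3 n (a b c : 'I_n) :
  (a < b < c)%N -> enum [set a; b; c] = [:: a; b; c].
Proof.
move=> /andP[ab bc]; apply: (@irr_sorted_eq _ (fun x y : 'I_n => x < y)%N).
- by move=> x y z; apply: ltn_trans.
- by move=> x; apply: ltnn.
- rewrite /enum_mem; apply: sorted_filter; first by move=> x y z; apply: ltn_trans.
  by have := iota_ltn_sorted 0 n; rewrite -val_enum_ord sorted_map enumT.
- by rewrite /= ab bc.
by move=> x; rewrite mem_enum !inE orbA.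
Qed.

Lemma set_rot n (a b c : 'I_n) : [set a; b; c] = [set b; c; a].
Proof. by rewrite -setUA setUC. Qed.

(** Going round from i, the indices pass from n - 1 to 0 at most once; the three
    places where this can happen give the three rotations of the triple. *)
Lemma set_value_shift (R : realType) (n : nat)
    (v : {rmorphism grass_ring R n -> R[i]}) (i : 'I_n) (d e : nat) :
  (0 < d)%N -> (d < e)%N -> (e < n)%N ->
  set_value v [set i; shift i d; shift i e] =
  v (Plucker R i (shift i d) (shift i e)).
Proof.
move=> d0 de en; have P := plucker_function_morph v.
have increasing (a b c : 'I_n) : (a < b < c)%N ->
    set_value v [set a; b; c] = v (Plucker R a b c).
  by rewrite /set_value => /enum_set3 ->.
have no_wrap k : (i + k < n)%N -> shift i k = (i + k)%N :> nat.
  by move=> ikn; rewrite val_shift modn_small.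
have wrap k : (k < n)%N -> (n <= i + k)%N -> shift i k = (i + k - n)%N :> nat.
  move=> kn nik; rewrite val_shift -[in LHS](subnK nik) modnDr modn_small //.
  by have := ltn_ord i; lia.
have in_n := ltn_ord i; have dn := ltn_trans de en.
case: (ltnP (i + e) n) => he.
  have hd : (i + d < n)%N by lia.
  by apply: increasing; rewrite !no_wrap //; lia.
case: (ltnP (i + d) n) => hd.
  rewrite -set_rot increasing; last by rewrite (no_wrap d) // (wrap e) //; lia.
  exact/esym/(plucker_rot _ _ _ P).
rewrite set_rot increasing; last by rewrite (wrap d) // (wrap e) //; lia.
exact: (plucker_rot _ _ _ P).
Qed.

(** * The recursive formulas *)

Theorem theorem2p11 (R : realType) (n : nat) (n_ge5 : (5 <= n)%N)
    (v : {lrmorphism grass_ring R n -> R[i] | *%R})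
    (v_continuous : forall i : 'I_n,
       set_value v [set i; shift i 1; shift i 2] = 1) :
  (forall (i : 'I_n) (k : nat), (3 <= k)%N -> (k < n - 3)%N ->
     Delta_lower v k i =
       Delta_lower v 1 i * Delta_lower v (k - 1) (shift i 1)
       - Delta_upper v 1 (shift i 1) * Delta_lower v (k - 2) (shift i 2)
       + Delta_lower v (k - 3) (shift i 3)
     /\
     Delta_upper v k i =
       Delta_upper v 1 (shift i (k - 1)) * Delta_upper v (k - 1) i
       - Delta_lower v 1 (shift i (k - 2)) * Delta_upper v (k - 2) i
       + Delta_upper v (k - 3) i)
  /\
  (forall i : 'I_n,
     Delta_lower v 2 i =
       Delta_lower v 1 i * Delta_lower v 1 (shift i 1)
       - Delta_upper v 1 (shift i 1)
     /\
     Delta_upper v 2 i =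
       Delta_upper v 1 (shift i 1) * Delta_upper v 1 i
       - Delta_lower v 1 i).
Proof.
pose p a b c := v (Plucker R a b c).
have P : plucker_function p := plucker_function_morph v.
have cont i j : p (shift i j) (shift i j.+1) (shift i j.+2) = 1.
  have := v_continuous (shift i j).
  by rewrite set_value_shift ?shift_shift ?add1n ?add2n //; lia.
have lowerE k i j : (k + 2 < n)%N -> Delta_lower v k (shift i j) =
    p (shift i j) (shift i j.+1) (shift i (k + 2 + j)).
  move=> kn; rewrite /Delta_lower set_value_shift ?shift_shift ?add1n //; lia.
have upperE k i j : (k + 2 < n)%N -> Delta_upper v k (shift i j) =
    p (shift i j) (shift i (k + 1 + j)) (shift i (k + 2 + j)).
  move=> kn; rewrite /Delta_upper set_value_shift ?shift_shift //; lia.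
have recL i x : p i (shift i 1) x =
    p i (shift i 1) (shift i 3) * p (shift i 1) (shift i 2) x
    - p (shift i 1) (shift i 3) (shift i 4) * p (shift i 2) (shift i 3) x
    + p (shift i 3) (shift i 4) x.
  exact: (plucker_recursion x P (cont i 0) (cont i 1) (cont i 2)).
have recU i x j : p x (shift i (3 + j)) (shift i (4 + j)) =
    p (shift i (1 + j)) (shift i (3 + j)) (shift i (4 + j))
      * p x (shift i (2 + j)) (shift i (3 + j))
    - p (shift i j) (shift i (1 + j)) (shift i (3 + j))
      * p x (shift i (1 + j)) (shift i (2 + j))
    + p x (shift i j) (shift i (1 + j)).
  exact: (plucker_recursion_rev x P (cont i j) (cont i j.+1) (cont i j.+2)).
have lower0 k i : (k + 2 < n)%N -> Delta_lower v k i =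
    p i (shift i 1) (shift i (k + 2)).
  by move=> kn; rewrite -[in LHS](erefl : shift i 0 = i) lowerE // addn0.
have upper0 k i : (k + 2 < n)%N -> Delta_upper v k i =
    p i (shift i (k + 1)) (shift i (k + 2)).
  by move=> kn; rewrite -[in LHS](erefl : shift i 0 = i) upperE // !addn0.
split=> [i k k3 kn|i]; split.
- rewrite !lowerE ?upperE ?lower0; try lia.
  have -> : (k - 1 + 2 + 1 = k + 2)%N by lia.
  have -> : (k - 2 + 2 + 2 = k + 2)%N by lia.
  have -> : (k - 3 + 2 + 3 = k + 2)%N by lia.
  exact: recL.
- rewrite !upperE ?lowerE ?upper0; try lia.
  have -> : (k - 3 + 1 = k - 2)%N by lia.
  have -> : (k - 3 + 2 = (k - 2).+1)%N by lia.
  have -> : (k - 1 + 1 = (k - 2).+2)%N by lia.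
  have -> : (k - 1 + 2 = (k - 2).+3)%N by lia.
  have -> : (k - 2 + 1 = (k - 2).+1)%N by lia.
  have -> : (k - 2 + 2 = (k - 2).+2)%N by lia.
  have -> : (k + 1 = (k - 2).+3)%N by lia.
  have -> : (k + 2 = (k - 2).+4)%N by lia.
  have -> : (k - 1 = (k - 2).+1)%N by lia.
  exact: recU.
- rewrite !lowerE ?upperE ?lower0; try lia.
  by rewrite recL (plucker_abb _ _ P) (cont i 2%N) mulr1 addr0.
rewrite !upperE ?lower0 ?upper0; try lia.
by rewrite (recU i i 0%N) (plucker_aab _ _ P) (cont i 0%N) mulr1 addr0.
Qed.
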